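(* Let $E$ be an sc-Banach space and $V=[0,\infty)^l\times\mathbb R^{n-l}\subset\mathbb R^n$. Let $f:\mathcal O(V\oplus E,0)\to(E,0)$ be an $\mathrm{sc}^0$-contraction germ which is of class $\mathrm{sc}^1$. Then the unique $\mathrm{sc}^0$-germ $\delta:\mathcal O(V,0)\to(E,0)$ satisfying $f(v,\delta(v))=0$ is also of class $\mathrm{sc}^1$.
   Context: An sc-Banach space is a Banach space $E$ with a nested sequence of Banach spaces $E=E_0\supset E_1\supset\cdots$ such that for $m<n$ the inclusion $E_n\to E_m$ is compact and $E_\infty=\bigcap_mE_m$ is dense in every $E_m$; $\|\cdot\|_m$ denotes the norm of $E_m$. Finite-dimensional spaces carry the constant structure, direct sums the levelwise one. For a closed subset $C$ of an sc-Banach space $E$, $C_m=C\cap E_m$; a germ of neighborhoods $\mathcal O(C,0)$ is a decreasing sequence $U_0\supset U_1\supset\cdots$ with $U_m$ a relatively open neighborhood of $0$ in $C_m$. An $\mathrm{sc}^0$-germ $f:\mathcal O(C,0)\to(F,0)$ is a continuous $f:U_0\to F_0$ with $f(0)=0$, $f(U_m)\subset F_m$ and $f:U_m\to F_m$ continuous for all $m$. The tangent germ $T\mathcal O(C,0)$ is the sequence $(U_{m+1}\oplus E_m)_{m\ge0}$ in the sc-Banach space $TE=E_1\oplus E_0$ with levels $(TE)_m=E_{m+1}\oplus E_m$. An $\mathrm{sc}^0$-germ $f$ is of class $\mathrm{sc}^1$ if for every $x\in U_1$ there is $Df(x)\in\mathcal L(E_0,F_0)$ with $\|f(x+h)-f(x)-Df(x)h\|_0/\|h\|_1\to0$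 as $\|h\|_1\to0$ ($x+h\in U_1$), and the tangent map $Tf(x,h)=(f(x),Df(x)h)$ maps $U_{m+1}\oplus E_m$ into $F_{m+1}\oplus F_m$ and is an $\mathrm{sc}^0$-germ $T\mathcal O(C,0)\to(TF,0)$. An $\mathrm{sc}^0$-contraction germ is an $\mathrm{sc}^0$-germ $f:\mathcal O(V\oplus E,0)\to(E,0)$ of the form $f(v,u)=u-B(v,u)$ such that for every $m\ge0$ and every $0<\varepsilon<1$, $\|B(v,u)-B(v,u')\|_m\le\varepsilon\|u-u'\|_m$ for all $(v,u),(v,u')$ sufficiently close to $(0,0)$ in $V\oplus E_m$ (closeness depending on $m,\varepsilon$). Such a germ has a unique $\mathrm{sc}^0$-solution germ $\delta$ with $f(v,\delta(v))=0$. *)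

(* Defs.v *)
From HB Require Import structures.
From mathcomp Require Import all_boot all_order all_algebra.
From mathcomp Require Import classical_sets reals.

Set Implicit Arguments.
Unset Strict Implicit.
Unset Printing Implicit Defensive.

Import Order.TTheory GRing.Theory Num.Theory.
Local Open Scope classical_set_scope.
Local Open Scope ring_scope.

Section SC.
Variable R : realType.

(** * sc-Banach spaces.
    An sc-structure on a real vector space X is given by the level sets
    [lvl m] (= E_m as a subset of E = E_0) and the level norms [nm m]
    (= the norm of E_m). *)

Definition is_norm_on (X : lmodType R) (A : set X) (N : X -> R) : Prop :=
  [/\ forall x, A x -> 0 <= N x,
      forall x, A x -> N x = 0 -> x = 0,
      forall x y, A x -> A y -> N (x + y) <= N x + N y &
      forall (a : R) x, A x -> N (a *: x) = `|a| * N x].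

Definition is_subspace (X : lmodType R) (A : set X) : Prop :=
  [/\ A 0, forall x y, A x -> A y -> A (x + y) &
      forall (a : R) x, A x -> A (a *: x)].

Definition is_complete_in (X : lmodType R) (A : set X) (N : X -> R) : Prop :=
  forall s : nat -> X, (forall k, A (s k)) ->
    (forall eps : R, 0 < eps -> exists K, forall i j,
        (K <= i)%N -> (K <= j)%N -> N (s i - s j) < eps) ->
    exists x, A x /\ (forall eps : R, 0 < eps -> exists K, forall k,
        (K <= k)%N -> N (s k - x) < eps).

Definition is_sc (X : lmodType R) (lvl : nat -> set X) (nm : nat -> X -> R)
  : Prop :=
  [/\ lvl 0%N = setT,
      forall m, is_subspace (lvl m) /\ is_norm_on (lvl m) (nm m)
                /\ is_complete_in (lvl m) (nm m),
      forall m, lvl m.+1 `<=` lvl m,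
      (* the inclusion E_n -> E_m (m < n) is compact: bounded sequences in
         E_n have subsequences converging in E_m *)
      forall m n, (m < n)%N -> forall s : nat -> X, (forall k, lvl n (s k)) ->
        (exists M : R, forall k, nm n (s k) <= M) ->
        exists (phi : nat -> nat) (x : X),
          (forall k, (phi k < phi k.+1)%N) /\ lvl m x /\
          (forall eps : R, 0 < eps -> exists K, forall k,
              (K <= k)%N -> nm m (s (phi k) - x) < eps) &
      forall m x, lvl m x -> forall eps : R, 0 < eps ->
        exists y, (forall k, lvl k y) /\ nm m (x - y) < eps].

Definition nbhd_germ (X : lmodType R) (lvl : nat -> set X) (nm : nat -> X -> R)
  (C : set X) (U : nat -> set X) : Prop :=
  [/\ forall m, U m.+1 `<=` U m,
      forall m, U m `<=` C `&` lvl m,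
      forall m, U m 0 &
      forall m x, U m x -> exists r : R, 0 < r /\
        forall y, C y -> lvl m y -> nm m (y - x) < r -> U m y].

Definition cont_on (X Y : lmodType R) (A : set X) (NX : X -> R) (NY : Y -> R)
  (f : X -> Y) : Prop :=
  forall x, A x -> forall eps : R, 0 < eps -> exists del : R, 0 < del /\
    forall y, A y -> NX (y - x) < del -> NY (f y - f x) < eps.

Definition sc0_germ (X Y : lmodType R)
  (lvlX : nat -> set X) (nmX : nat -> X -> R)
  (lvlY : nat -> set Y) (nmY : nat -> Y -> R)
  (C : set X) (U : nat -> set X) (f : X -> Y) : Prop :=
  [/\ nbhd_germ lvlX nmX C U,
      f 0 = 0,
      forall m x, U m x -> lvlY m (f x) &
      forall m, cont_on (U m) (nmX m) (nmY m) f].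

(** * Tangent structure TE = E_1 ⊕ E_0, levels E_{m+1} ⊕ E_m *)
Definition tlvl (X : lmodType R) (lvl : nat -> set X) : nat -> set (X * X) :=
  fun m p => lvl m.+1 p.1 /\ lvl m p.2.
Definition tnm (X : lmodType R) (nm : nat -> X -> R) : nat -> X * X -> R :=
  fun m p => nm m.+1 p.1 + nm m p.2.
Definition tset (X : lmodType R) (lvl : nat -> set X) (C : set X) : set (X * X) :=
  fun p => C p.1 /\ lvl 1%N p.1.
Definition tgerm (X : lmodType R) (lvl : nat -> set X) (U : nat -> set X)
  : nat -> set (X * X) :=
  fun m p => U m.+1 p.1 /\ lvl m p.2.

Definition sc1_germ (X Y : lmodType R)
  (lvlX : nat -> set X) (nmX : nat -> X -> R)
  (lvlY : nat -> set Y) (nmY : nat -> Y -> R)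
  (C : set X) (U : nat -> set X) (f : X -> Y) : Prop :=
  sc0_germ lvlX nmX lvlY nmY C U f /\
  exists Df : X -> X -> Y,
    (forall x, U 1%N x ->
       (forall (a : R) h k, Df x (a *: h + k) = a *: Df x h + Df x k) /\
       (exists c : R, forall h, nmY 0%N (Df x h) <= c * nmX 0%N h) /\
       (forall eps : R, 0 < eps -> exists del : R, 0 < del /\
          forall h, U 1%N (x + h) -> nmX 1%N h < del ->
            nmY 0%N (f (x + h) - f x - Df x h) <= eps * nmX 1%N h)) /\
    sc0_germ (tlvl lvlX) (tnm nmX) (tlvl lvlY) (tnm nmY)
             (tset lvlX C) (tgerm lvlX U) (fun p => (f p.1, Df p.1 p.2)).

Definition rnorm (n : nat) (v : 'rV[R]_n) : R := \sum_(i < n) `|v ord0 i|.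
Definition rn_lvl (n : nat) : nat -> set 'rV[R]_n := fun _ => setT.
Definition rn_nm (n : nat) : nat -> 'rV[R]_n -> R := fun _ => @rnorm n.
Definition quadrant (n l : nat) : set 'rV[R]_n :=
  fun v => forall i : 'I_n, (i < l)%N -> 0 <= v ord0 i.

Definition sum_lvl (n : nat) (E : lmodType R) (lvlE : nat -> set E)
  : nat -> set ('rV[R]_n * E) := fun m p => lvlE m p.2.
Definition sum_nm (n : nat) (E : lmodType R) (nmE : nat -> E -> R)
  : nat -> 'rV[R]_n * E -> R := fun m p => rnorm p.1 + nmE m p.2.
Definition quadE (n l : nat) (E : lmodType R) : set ('rV[R]_n * E) :=
  fun p => quadrant l p.1.

Definition sc0_contraction_germ (n l : nat) (E : lmodType R)
  (lvlE : nat -> set E) (nmE : nat -> E -> R)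
  (U : nat -> set ('rV[R]_n * E)) (f : 'rV[R]_n * E -> E) : Prop :=
  sc0_germ (@sum_lvl n E lvlE) (@sum_nm n E nmE) lvlE nmE (@quadE n l E) U f /\
  let B := fun p : 'rV[R]_n * E => p.2 - f p in
  forall m (eps : R), 0 < eps < 1 -> exists rho : R, 0 < rho /\
    forall v u u', U m (v, u) -> U m (v, u') ->
      @sum_nm n E nmE m (v, u) < rho -> @sum_nm n E nmE m (v, u') < rho ->
      nmE m (B (v, u) - B (v, u')) <= eps * nmE m (u - u').

End SC.

(* Main.v *)
(* With [f (v, u) = u - B (v, u)], the contraction property makes the partial
   derivative [D_2 B (v, delta v)] of norm at most 1/2 on each level [E_m], so
   the linearized equation [Df (v, delta v) (b, w) = 0] has a unique solution
   [w], which lies in [E_m] as soon as [delta v] is in [E_(m+1)] and depends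
   continuously on [(v, b)]. This [w] is the derivative of [delta] at [v] applied
   to [b]: since [f] is differentiable only along increments measured in [E_1],
   one needs that [delta] is Lipschitz at [v] into [E_1], which follows from the
   contraction property in [E_1] and a mean value inequality for
   [f (v + t b, delta v)].
   Differentiability is only given in [E_0]; all estimates in higher levels are
   obtained without integration, from the compactness of [E_(m+1)] in [E_m]. *)
Require Import Defs.
From HB Require Import structures.
From mathcomp Require Import all_boot all_order all_algebra.
From mathcomp Require Import boolp classical_sets reals.
From mathcomp Require Import ring lra zify.

Import Order.TTheory GRing.Theory Num.Theory.
Local Open Scope classical_set_scope.
Local Open Scope ring_scope.

(** * Norms, compactness and mean value inequalities in an sc-Banach space *)

Section ScSpace.
Context {R : realType} {E : lmodType R}.
Context {lvl : nat -> set E} {nm : nat -> E -> R}.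
Hypothesis scE : is_sc lvl nm.

Lemma lvl0T x : lvl 0%N x.
Proof. by case: scE => ->. Qed.

Lemma lvl0 m : lvl m 0.
Proof. by case: scE => _ /(_ m)[[]]. Qed.

Lemma lvlD m x y : lvl m x -> lvl m y -> lvl m (x + y).
Proof. by case: scE => _ /(_ m)[[_ h _] _] _ _ _; apply: h. Qed.

Lemma lvlZ m a x : lvl m x -> lvl m (a *: x).
Proof. by case: scE => _ /(_ m)[[_ _ h] _] _ _ _; apply: h. Qed.

Lemma lvlN m x : lvl m x -> lvl m (- x).
Proof. by rewrite -scaleN1r; apply: lvlZ. Qed.

Lemma lvlB m x y : lvl m x -> lvl m y -> lvl m (x - y).
Proof. by move=> hx hy; apply: lvlD => //; apply: lvlN. Qed.

Lemma lvl_anti {m n} : (m <= n)%N -> lvl n `<=` lvl m.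
Proof.
case: scE => _ _ h _ _ /subnK <-; elim: (n - m)%N => // k IH.
by rewrite addSn; exact: subset_trans (h _) IH.
Qed.

Lemma nm_ge0 {m x} : lvl m x -> 0 <= nm m x.
Proof. by case: scE => _ /(_ m)[_ [[h _ _ _] _]] _ _ _; apply: h. Qed.

Lemma nm_eq0 {m x} : lvl m x -> nm m x = 0 -> x = 0.
Proof. by case: scE => _ /(_ m)[_ [[_ h _ _] _]] _ _ _; apply: h. Qed.

Lemma nmD {m x y} : lvl m x -> lvl m y -> nm m (x + y) <= nm m x + nm m y.
Proof. by case: scE => _ /(_ m)[_ [[_ _ h _] _]] _ _ _; apply: h. Qed.

Lemma nmZ {m} a {x} : lvl m x -> nm m (a *: x) = `|a| * nm m x.
Proof. by case: scE => _ /(_ m)[_ [[_ _ _ h] _]] _ _ _; apply: h. Qed.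

Lemma nm0 m : nm m 0 = 0.
Proof. by rewrite -(scaler0 _ 0) nmZ ?normr0 ?mul0r //; exact: lvl0. Qed.

Lemma nmN {m x} : lvl m x -> nm m (- x) = nm m x.
Proof. by move=> hx; rewrite -scaleN1r nmZ // normrN1 mul1r. Qed.

Lemma nmB {m x y} : lvl m x -> lvl m y -> nm m (x - y) <= nm m x + nm m y.
Proof. by move=> hx hy; rewrite -(nmN hy); apply: nmD => //; apply: lvlN. Qed.

Lemma nm_distC {m x y} : lvl m x -> lvl m y -> nm m (x - y) = nm m (y - x).
Proof. by move=> hx hy; rewrite -opprB nmN //; apply: lvlB. Qed.

Lemma nm_dist_trans {m x} y {z} : lvl m x -> lvl m y -> lvl m z ->
  nm m (x - z) <= nm m (x - y) + nm m (y - z).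
Proof.
by move=> hx hy hz; rewrite -{1}(subrK y x) -addrA; apply: nmD; apply: lvlB.
Qed.

Lemma nm_le0 {m x} : lvl m x -> nm m x <= 0 -> x = 0.
Proof. by move=> hx h; apply: (nm_eq0 hx); have := nm_ge0 hx; lra. Qed.

(** A compact operator is bounded: otherwise the unit ball of E_n contains vectors of arbitrarily
    large E_m-norm, and no subsequence of these can converge in E_m. *)
Lemma incl_bounded {m n} : (m < n)%N ->
  exists2 C : R, 0 < C & forall x, lvl n x -> nm m x <= C * nm n x.
Proof.
move=> mn; apply: contrapT => hC.
have hs (k : nat) : exists x, [/\ lvl n x, nm n x <= 1 & k%:R < nm m x].
  apply: contrapT => hk; apply: hC; exists k.+1%:R; first by rewrite ltr0n.
  move=> x hx; have hx' := lvl_anti (ltnW mn) _ hx.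
  have [h0|h0] := ltrP 0 (nm n x); last first.
    by rewrite (nm_le0 hx h0) !nm0 mulr0.
  rewrite leNgt; apply/negP => hlt; apply: hk.
  exists ((nm n x)^-1 *: x); split; first exact: lvlZ.
    by rewrite nmZ // gtr0_norm ?invr_gt0 // mulVf // gt_eqF.
  rewrite nmZ // gtr0_norm ?invr_gt0 // mulrC ltr_pdivlMr //.
  by apply: le_lt_trans hlt; apply: ler_wpM2r; [exact: ltW|rewrite ler_nat].
have [s hs'] := choice hs.
case: scE => _ _ _ /(_ m n mn s) hcomp _.
have [||phi [x [hphi [hx hlim]]]] := hcomp.
- by move=> k; case: (hs' k).
- by exists 1 => k; case: (hs' k).
have phi_ge k : (k <= phi k)%N.
  by elim: k => // k IH; apply: leq_ltn_trans IH (hphi k).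
have [K hK] := hlim 1 ltr01.
(* At this index [s (phi k)] is within 1 of [x] and yet has norm above [nm m x + 1]. *)
set k := maxn K (Num.truncn (nm m x + 1)).+1.
have := hK k (leq_maxl _ _).
have [h1 _ h2] := hs' (phi k).
have h1' := lvl_anti (ltnW mn) _ h1.
have h3 : nm m x + 1 < (phi k)%:R.
  apply: lt_le_trans (truncnS_gt _) _; rewrite ler_nat.
  exact: leq_trans (leq_maxr _ _) (phi_ge k).
have := nmD (lvlB _ _ _ h1' hx) hx; rewrite subrK.
lra.
Qed.

(* Compactness replaces reflexivity: a limit in [E_0] of a sequence bounded in
   [E_(m+1)] is also its limit in [E_m]. *)
Lemma bounded_limit m x (M M' : R) :
  (forall eps : R, 0 < eps -> exists y,
     [/\ lvl m.+1 y, nm m.+1 y <= M, nm m y <= M' & nm 0%N (y - x) < eps]) ->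
  lvl m x /\ nm m x <= M'.
Proof.
move=> h.
have hs (k : nat) : exists y,
    [/\ lvl m.+1 y, nm m.+1 y <= M, nm m y <= M' & nm 0%N (y - x) < k.+1%:R^-1].
  by apply: h; rewrite invr_gt0 ltr0n.
have [s hs'] := choice hs.
case: scE => _ _ _ /(_ m m.+1 (ltnSn _) s) hcomp _.
have [||phi [y [hphi [hy hlim]]]] := hcomp.
- by move=> k; case: (hs' k).
- by exists M => k; case: (hs' k).
have phi_ge k : (k <= phi k)%N.
  by elim: k => // k IH; apply: leq_ltn_trans IH (hphi k).
have sm k : lvl m (s k) by apply: (lvl_anti (leqnSn m)); case: (hs' k).
have [C C0 hC] : exists2 C : R, 0 < C &
    forall x, lvl m x -> nm 0%N x <= C * nm m x.
  case: (posnP m) => [->|m0]; last exact: incl_bounded m0.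
  by exists 1 => // z _; rewrite mul1r.
(* The E_m-limit [y] of the subsequence is also its E_0-limit, and E_0-limits are unique. *)
have yx : y = x.
  apply/eqP; rewrite -subr_eq0; apply/eqP.
  apply: (nm_le0 (lvl0T _)); apply/ler_addgt0Pr => e e0; rewrite add0r.
  have e1 : 0 < e / (2 * C) by rewrite divr_gt0 // mulr_gt0.
  have [K hK] := hlim _ e1.
  set k := maxn K (Num.truncn (2 / e)).+1.
  have h1 := hK k (leq_maxl _ _).
  have [_ _ _ h2] := hs' (phi k).
  have h3 : (phi k).+1%:R^-1 <= e / 2.
    rewrite -[e / 2]invrK invf_div lef_pV2 ?posrE ?ltr0n ?divr_gt0 //.
    apply: le_trans (ltW (truncnS_gt _)) _; rewrite ler_nat.
    by apply: leq_trans (leq_maxr K _) _; apply: leq_trans (phi_ge k) _.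
  have h4 := nm_dist_trans (s (phi k)) (lvl0T y) (lvl0T _) (lvl0T x).
  rewrite (nm_distC (lvl0T y) (lvl0T (s _))) in h4.
  have h5 := hC _ (lvlB _ _ _ (sm (phi k)) hy).
  have h6 : C * nm m (s (phi k) - y) <= e / 2.
    rewrite mulrC -ler_pdivlMr // -mulrA -invfM; exact: ltW.
  have h7 := lt_le_trans h2 h3; move: h7 h4 h5 h6; clear -e0; lra.
rewrite -yx; split=> //; apply/ler_addgt0Pr => e e0.
have [K hK] := hlim _ e0.
have := hK K (leqnn _); have [_ _ h2 _] := hs' (phi K).
have := nmB (sm (phi K)) (lvlB _ _ _ (sm (phi K)) hy).
rewrite subKr; lra.
Qed.

(* [y] is a Riemann sum of [g] for a tagged partition subordinate to the
   moduli of differentiability of [c]. *)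
Lemma mean_value_approx m (c g : R -> E) (M eps : R) :
  0 < eps ->
  (forall t, 0 <= t <= 1 -> lvl m (g t) /\ nm m (g t) <= M) ->
  (forall t, 0 <= t <= 1 -> exists2 del : R, 0 < del &
     forall s, 0 <= s <= 1 -> `|s - t| < del ->
       nm 0%N (c s - c t - (s - t) *: g t) <= eps * `|s - t|) ->
  exists y, [/\ lvl m y, nm m y <= M & nm 0%N (c 1 - c 0 - y) <= eps].
Proof.
move=> eps0 hg hc.
(* The claim on [a, b], with both bounds proportional to the length so that they add up over
   adjacent intervals. *)
pose P a b := exists y, [/\ lvl m y, nm m y <= M * (b - a) &
  nm 0%N (c b - c a - y) <= eps * (b - a)].
have Padd a b d : P a b -> P b d -> P a d.
  move=> [y [y1 y2 y3]] [z [z1 z2 z3]]; exists (y + z); split.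
  - exact: lvlD.
  - by have := nmD y1 z1; lra.
  - have -> : c d - c a - (y + z) = (c b - c a - y) + (c d - c b - z).
      rewrite addrACA -opprD; congr (_ - _).
      by rewrite addrC addrA subrK.
    have := nmD (lvl0T (c b - c a - y)) (lvl0T (c d - c b - z)); lra.
have Ploc a b t del : 0 <= t <= 1 ->
    (forall s, 0 <= s <= 1 -> `|s - t| < del ->
       nm 0%N (c s - c t - (s - t) *: g t) <= eps * `|s - t|) ->
    0 <= a -> a <= b -> b <= 1 -> (t = a \/ t = b) -> b - a < del -> P a b.
  move=> ht hdel a0 ab b1 hab hlt; have [g1 g2] := hg t ht.
  exists ((b - a) *: g t); split; first exact: lvlZ.
    rewrite nmZ // ger0_norm ?subr_ge0 // mulrC.
    by apply: ler_wpM2r; rewrite ?subr_ge0.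
  case: hab => e; rewrite e in hdel *.
    rewrite -[X in eps * X]ger0_norm ?subr_ge0 //; apply: hdel; first lra.
    by rewrite ger0_norm ?subr_ge0.
  have -> : c b - c a - (b - a) *: g b = - (c a - c b - (a - b) *: g b).
    by rewrite -(opprB a b) scaleNr opprK opprB opprB addrC.
  rewrite nmN; last exact: lvl0T.
  rewrite -[X in eps * X]ger0_norm ?subr_ge0 // distrC; apply: hdel; first lra.
  by rewrite distrC ger0_norm ?subr_ge0.
have Prefl a : P a a.
  by exists 0; split; rewrite ?subrr ?mulr0 ?subr0 ?nm0 //; exact: lvl0.
(* A supremum argument stands in for the compactness of [0, 1]: [S] contains its supremum, and a
   supremum below 1 could be passed by a short interval tagged there. *)
pose S := [set t : R | 0 <= t <= 1 /\ P 0 t].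
have S0 : S 0 by split; [rewrite lexx ler01|exact: Prefl].
have supS : has_sup S.
  by split; [exists 0|exists 1 => t [/andP[]]].
set t := sup S.
have t01 : 0 <= t <= 1.
  apply/andP; split; first exact: ub_le_sup (proj2 supS) _ S0.
  by apply: ge_sup; [exists 0|move=> z [/andP[]]].
have [del del0 hdel] := hc t t01.
have [s [s01 Ps] hs] := sup_adherent del0 supS.
have st : s <= t by apply: (ub_le_sup (proj2 supS)).
have Pt : P 0 t.
  apply: Padd Ps _; apply: (Ploc s t t del) => //; [lra|lra|by right|].
  rewrite -/t in hs; lra.
have [t1|t1] := ltrP t 1; last first.
  have e : t = 1 by lra.
  by case: Pt => y; rewrite e subr0 !mulr1 => hy; exists y.
pose r := Num.min 1 (t + del / 2).
have r1 : r <= 1 by rewrite /r ge_min lexx.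
have r2 : r <= t + del / 2 by rewrite /r ge_min lexx orbT.
have r3 : t < r by rewrite /r lt_min t1 /=; lra.
have : S r.
  split; first lra.
  apply: Padd Pt _; apply: (Ploc t r t del) => //; [lra|lra|by left|lra].
by move=> /(ub_le_sup (proj2 supS)); rewrite -/t; lra.
Qed.

(** The Riemann sums of [mean_value_approx] stay bounded in E_(m+1) and converge to [c 1 - c 0] in
    E_0 only; [bounded_limit] turns this into a bound in E_m, at the cost of one level. [C] is the
    norm of the inclusion and does not depend on the path. *)
Lemma mean_value_bound m : exists2 C : R, 0 < C &
  forall (c g : R -> E) (M : R),
  (forall t, 0 <= t <= 1 -> lvl m.+1 (g t) /\ nm m.+1 (g t) <= M) ->
  (forall t, 0 <= t <= 1 -> forall eps : R, 0 < eps ->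
   exists2 del : R, 0 < del &
     forall s, 0 <= s <= 1 -> `|s - t| < del ->
       nm 0%N (c s - c t - (s - t) *: g t) <= eps * `|s - t|) ->
  nm m (c 1 - c 0) <= C * M.
Proof.
have [C C0 hC] := incl_bounded (ltnSn m).
exists C => // c g M hg hc.
apply: (proj2 (bounded_limit m _ M (C * M) _)) => eps eps0.
have [||y [y1 y2 y3]] := mean_value_approx m.+1 c g M (eps / 2) _ hg.
- lra.
- by move=> t ht; apply: (hc t ht); lra.
exists y; split=> //; last first.
  by rewrite (nm_distC (lvl0T _) (lvl0T _)); lra.
by apply: le_trans (hC _ y1) _; rewrite ler_pM2l.
Qed.

(** Picard iteration from 0 in the complete space E_m. The contraction is required on E_m alone, so
    the fixed point is found at that level. *)
Lemma contraction_fixpoint m (T : E -> E) :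
  (forall x, lvl m x -> lvl m (T x)) ->
  (forall x y, lvl m x -> lvl m y ->
     nm m (T x - T y) <= 2^-1 * nm m (x - y)) ->
  exists2 x, lvl m x & T x = x.
Proof.
move=> hT1 hT2; pose w k := iter k T 0.
have wl k : lvl m (w k).
  by elim: k => [|k IH]; [exact: lvl0|apply: hT1].
pose D := nm m (w 1%N - w 0%N).
have D0 : 0 <= D by apply: nm_ge0; apply: lvlB.
have step k : nm m (w k.+1 - w k) <= 2^-1 ^+ k * D.
  elim: k => [|k IH]; first by rewrite expr0 mul1r.
  apply: le_trans (hT2 _ _ (wl k.+1) (wl k)) _.
  by rewrite exprS -mulrA ler_pM2l ?invr_gt0.
have hp k : 0 < 2^-1 ^+ k :> R by rewrite exprn_gt0 // invr_gt0.
(* The factor is the closed form of the geometric sum of 2^-k over i <= k < i + j. *)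
have dist i j : nm m (w (i + j)%N - w i) <=
    2 * (2^-1 ^+ i - 2^-1 ^+ (i + j)) * D.
  elim: j => [|j IH]; first by rewrite addn0 !subrr mulr0 mul0r nm0.
  rewrite addnS.
  have := nm_dist_trans (w (i + j)%N) (wl (i + j).+1) (wl _) (wl i).
  have := step (i + j)%N; rewrite exprS; lra.
have dist' i j : (i <= j)%N -> nm m (w j - w i) <= 2 * 2^-1 ^+ i * D.
  move=> /subnKC <-; apply: le_trans (dist i _) _.
  apply: ler_wpM2r => //; have := hp (i + (j - i))%N; lra.
have small (e : R) : 0 < e -> exists K, 2 * 2^-1 ^+ K * D < e.
  move=> e0; have h1 := truncnS_gt (2 * D / e).
  set K := (Num.truncn _).+1 in h1; exists K.
  have h2 : K%:R <= 2 ^+ K :> R by rewrite -natrX ler_nat ltnW // ltn_expl.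
  rewrite exprVn mulrAC ltr_pdivrMr ?exprn_gt0 //.
  rewrite ltr_pdivrMr // in h1; apply: lt_le_trans h1 _.
  by rewrite mulrC ler_pM2l.
case: scE => _ /(_ m)[_ [_ hcomplete]] _ _ _.
have [|x [hx hlim]] := hcomplete w wl.
  move=> e e0; have [K hK] := small _ e0; exists K => i j Ki Kj.
  have h (i' j' : nat) : (K <= i')%N -> (i' <= j')%N ->
      nm m (w j' - w i') < e.
    move=> Ki' ij; apply: le_lt_trans (dist' _ _ ij) _.
    apply: le_lt_trans hK; apply: ler_wpM2r => //; rewrite ler_pM2l //.
    by apply: ler_wiXn2l => //; rewrite ?invr_ge0 // invf_le1 // ler1n.
  case: (leqP i j) => ij; last exact: h _ _ Kj (ltnW ij).
  by rewrite (nm_distC (wl _) (wl _)); exact: h.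
exists x => //; apply/eqP; rewrite -subr_eq0; apply/eqP.
apply: (nm_le0 (lvlB _ _ _ (hT1 _ hx) hx)); apply/ler_addgt0Pr => e e0.
have [K hK] := hlim (e / 2) ltac:(lra).
have h1 := hK K (leqnn _); have h2 := hK K.+1 (leqnSn _).
have := nm_dist_trans (w K.+1) (hT1 _ hx) (wl _) hx.
have := hT2 _ _ hx (wl K); rewrite -/(w K.+1) (nm_distC hx (wl K)).
lra.
Qed.

End ScSpace.

(** * The norm and the quadrant in R^n *)

Section RowNorm.
Context {R : realType} {n : nat}.
Implicit Types v w : 'rV[R]_n.

Lemma rnorm_ge0 v : 0 <= rnorm v.
Proof. exact: sumr_ge0. Qed.

Lemma rnormD v w : rnorm (v + w) <= rnorm v + rnorm w.
Proof.
rewrite -big_split /=; apply: ler_sum => i _; rewrite mxE; exact: ler_normD.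
Qed.

Lemma rnormZ a v : rnorm (a *: v) = `|a| * rnorm v.
Proof. by rewrite mulr_sumr; apply: eq_bigr => i _; rewrite mxE normrM. Qed.

Lemma rnorm0 : rnorm (0 : 'rV[R]_n) = 0.
Proof. by apply: big1 => i _; rewrite mxE normr0. Qed.

Lemma rnormN v : rnorm (- v) = rnorm v.
Proof. by rewrite -scaleN1r rnormZ normrN1 mul1r. Qed.

Lemma quadrant_convex l v b t : quadrant l v -> quadrant l (v + b) ->
  0 <= t <= 1 -> quadrant l (v + t *: b).
Proof.
move=> hv hvb ht i il; have := hv i il; have := hvb i il; rewrite !mxE.
set x := v ord0 i; set y := b ord0 i; nra.
Qed.

End RowNorm.

Lemma small_scale {R : realType} (d N : R) : 0 < d -> 0 <= N ->
  exists2 t0 : R, 0 < t0 & forall t, 0 <= t < t0 -> t * N < d.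
Proof.
(* The summand 1 keeps the denominator positive when [N] is 0. *)
move=> d0 N0; exists (d / (N + 1)); first by rewrite divr_gt0 //; lra.
move=> t /andP[t0]; rewrite ltr_pdivlMr; last lra.
nra.
Qed.

(** * The linearized equation and its solution on each level *)

Section Linearization.
Context {R : realType} {E : lmodType R}.
Context {lvl : nat -> set E} {nm : nat -> E -> R}.
Hypothesis scE : is_sc lvl nm.
Context {n l : nat} {U : nat -> set ('rV[R]_n * E)} {f : 'rV[R]_n * E -> E}.
Hypothesis hf0 : @sc0_contraction_germ R n l E lvl nm U f.
Context {Df : 'rV[R]_n * E -> 'rV[R]_n * E -> E}.
Hypothesis hDf : forall x, U 1%N x ->
  (forall (a : R) h k, Df x (a *: h + k) = a *: Df x h + Df x k) /\
  (exists c : R, forall h, nm 0%N (Df x h) <= c * sum_nm nm 0%N h) /\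
  (forall eps : R, 0 < eps -> exists del : R, 0 < del /\
     forall h, U 1%N (x + h) -> sum_nm nm 1%N h < del ->
       nm 0%N (f (x + h) - f x - Df x h) <= eps * sum_nm nm 1%N h).
Hypothesis hT :
  sc0_germ (tlvl (@sum_lvl R n E lvl)) (tnm (@sum_nm R n E nm))
    (tlvl lvl) (tnm nm) (tset (@sum_lvl R n E lvl) (@quadE R n l E))
    (tgerm (@sum_lvl R n E lvl) U) (fun p => (f p.1, Df p.1 p.2)).

Implicit Types p q : 'rV[R]_n * E.

Lemma germ_anti {m k} : (m <= k)%N -> U k `<=` U m.
Proof.
case: hf0 => -[[h _ _ _] _ _ _] _ /subnK <-; elim: (k - m)%N => // j IH.
by rewrite addSn; exact: subset_trans (h _) IH.
Qed.

Lemma germS1 {m p} : U m.+1 p -> U 1%N p.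
Proof. exact: germ_anti. Qed.

Lemma DfD p h k : U 1%N p -> Df p (h + k) = Df p h + Df p k.
Proof. by move=> /hDf[H _]; have := H 1 h k; rewrite !scale1r. Qed.

Lemma Df0 p : U 1%N p -> Df p 0 = 0.
Proof.
by move=> /hDf[H _]; have := H (-1) 0 0; rewrite scaler0 addr0 scaleN1r addNr.
Qed.

Lemma DfZ p a h : U 1%N p -> Df p (a *: h) = a *: Df p h.
Proof.
by move=> hp; have [H _] := hDf p hp; have := H a h 0; rewrite Df0 // !addr0.
Qed.

Lemma DfB p h k : U 1%N p -> Df p (h - k) = Df p h - Df p k.
Proof. by move=> hp; rewrite DfD // -[- k]scaleN1r DfZ // scaleN1r. Qed.

Lemma Df_split p b w : U 1%N p -> Df p (b, w) = Df p (b, 0) + Df p (0, w).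
Proof.
by move=> hp; rewrite -DfD //; congr (Df p (_, _)); rewrite /= ?addr0 ?add0r.
Qed.

Lemma Df_subr p b w w' : U 1%N p ->
  Df p (0, w - w') = Df p (b, w) - Df p (b, w').
Proof.
by move=> hp; rewrite -DfB //; congr (Df p (_, _)); rewrite /= subrr.
Qed.

Lemma Df_lvl m p h : U m.+1 p -> lvl m h.2 -> lvl m (Df p h).
Proof.
move=> hp hh; case: hT => _ _ /(_ m (p, h)) H _.
by have [] := H (conj hp hh).
Qed.

(** This is the second component of the continuity of the tangent map. Its norm is a sum over the
    two components, hence the halved radius. *)
Lemma Df_continuous m p h (eps : R) : U m.+1 p -> lvl m h.2 -> 0 < eps ->
  exists2 del : R, 0 < del & forall q k, U m.+1 q -> lvl m k.2 ->
    sum_nm nm m.+1 (q - p) < del -> sum_nm nm m (k - h) < del ->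
    nm m (Df q k - Df p h) < eps.
Proof.
move=> hp hh e0; case: hT => _ _ hl /(_ m (p, h) (conj hp hh) eps e0).
move=> [del [d0 H]]; exists (del / 2); first lra.
move=> q k hq hk h1 h2.
have := H (q, k) (conj hq hk); rewrite /tnm /= => /(_ ltac:(lra)).
have [fq _] := hl m (q, k) (conj hq hk).
have [fp _] := hl m (p, h) (conj hp hh).
have := nm_ge0 scE (lvlB scE _ _ _ fq fp); rewrite /=; lra.
Qed.

Lemma sum_nm_ge0 m p : lvl m p.2 -> 0 <= sum_nm nm m p.
Proof.
move=> hp; have := nm_ge0 scE hp; have := rnorm_ge0 p.1; rewrite /sum_nm; lra.
Qed.

(** Continuity of the tangent map at [(p, 0)] gives a bound for small vectors, uniform in nearby
    base points, and homogeneity extends it to all vectors: if the bound failed at [k], rescaling to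
    make the image a unit vector would contradict continuity. *)
Lemma Df_bounded m p : U m.+1 p -> exists C del : R, [/\ 0 < C, 0 < del &
  forall q k, U m.+1 q -> sum_nm nm m.+1 (q - p) < del -> lvl m k.2 ->
    nm m (Df q k) <= C * sum_nm nm m k].
Proof.
move=> hp.
have [del d0 H] := Df_continuous m p 0 1 hp (lvl0 scE m) ltr01.
exists (2 / del), del; split => //; first by rewrite divr_gt0.
move=> q k hq hqp hk; rewrite leNgt; apply/negP => hlt.
have N0 := sum_nm_ge0 m k hk.
have D0 : 0 < nm m (Df q k).
  by apply: le_lt_trans hlt; rewrite mulr_ge0 // divr_ge0 // ltW.
set a := (nm m (Df q k))^-1.
have a0 : 0 < a by rewrite invr_gt0.
have ak : lvl m (a *: k).2 by exact: (lvlZ scE _ _ _ hk).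
have := H q (a *: k) hq ak hqp; rewrite subr0 (Df0 p (germS1 hp)) subr0.
rewrite (DfZ _ _ _ (germS1 hq)) (nmZ scE) ?gtr0_norm //; last exact: Df_lvl.
rewrite mulVf ?gt_eqF // ltxx => /(_ _) h; suff : false by []; apply: h.
rewrite /sum_nm /= rnormZ (nmZ scE) // gtr0_norm // -mulrDr.
rewrite mulrC ltr_pdivrMr //.
rewrite mulrAC ltr_pdivrMr // in hlt.
rewrite -/(sum_nm nm m k); nra.
Qed.

(** Fixes the contraction constant 1/2 and replaces the open set [U m] by a ball in the quadrant, so
    that membership becomes a norm inequality. *)
Definition contraction_radius m (s : R) := [/\ 0 < s,
  forall v u, quadrant l v -> lvl m u -> sum_nm nm m (v, u) < s -> U m (v, u) &
  forall v u u', quadrant l v -> lvl m u -> lvl m u' ->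
    sum_nm nm m (v, u) < s -> sum_nm nm m (v, u') < s ->
    nm m ((u - f (v, u)) - (u' - f (v, u'))) <= 2^-1 * nm m (u - u')].

Lemma contraction_radius_ex m : exists s, contraction_radius m s.
Proof.
case: hf0 => -[[_ _ h0 hU] _ _ _] /= hB.
have [r [r0 hr]] := hU m 0 (h0 m).
have h2 : 0 < (2^-1 : R) < 1 by rewrite invr_gt0 ltr0n /= invf_lt1 // ltr1n.
have [rho [rho0 hrho]] := hB m _ h2.
have hin v u : quadrant l v -> lvl m u ->
    sum_nm nm m (v, u) < Num.min r rho -> U m (v, u).
  move=> hv hu; rewrite lt_min => /andP[h _].
  by apply: hr => //; rewrite subr0.
exists (Num.min r rho); split=> //; first by rewrite lt_min r0.
move=> v u u' hv hu hu' h h'.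
apply: hrho; try exact: hin.
  by move: h; rewrite lt_min => /andP[].
by move: h'; rewrite lt_min => /andP[].
Qed.

(** The operator [k - Df p (0, k)] is the partial derivative D_2 B at [p]. *)
Definition D2_contraction m p :=
  forall k, lvl m k -> nm m (k - Df p (0, k)) <= 2^-1 * nm m k.

(* Here [B (v, u) = u - f (v, u)]. For smooth [k] the difference quotients of
   [B] are bounded in [E_(m+1)] and contracted in [E_m], so [bounded_limit]
   applies; density of smooth vectors does the rest. *)
Lemma D2_contractionP m (s s' : R) v u :
  contraction_radius m s -> contraction_radius m.+1 s' ->
  quadrant l v -> lvl m.+1 u -> sum_nm nm m (v, u) < s ->
  sum_nm nm m.+1 (v, u) < s' -> D2_contraction m (v, u).
Proof.
move=> [s0 sU sB] [s0' sU' sB'] hv hu hs hs'.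
have hu' := lvl_anti scE (leqnSn m) _ hu.
have hp : U m.+1 (v, u) by exact: sU'.
have hp1 := germS1 hp.
have smooth k : lvl m.+1 k -> nm m (k - Df (v, u) (0, k)) <= 2^-1 * nm m k.
  move=> hk; have hk' := lvl_anti scE (leqnSn m) _ hk.
  have hk1 := lvl_anti scE (ltn0Sn m) _ hk.
  apply: (proj2 (bounded_limit scE m _ (2^-1 * nm m.+1 k) _ _)) => eps eps0.
  have N1 := nm_ge0 scE hk1.
  have e0 : 0 < eps / (nm 1%N k + 1) by rewrite divr_gt0 //; lra.
  have [_ [_ hdiff]] := hDf _ hp1.
  have [del [del0 hdel]] := hdiff _ e0.
  have [||ta ta0 hta] := small_scale (s - sum_nm nm m (v, u)) (nm m k).
  - by lra.
  - exact: (nm_ge0 scE hk').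
  have [||tb tb0 htb] := small_scale (s' - sum_nm nm m.+1 (v, u)) (nm m.+1 k).
  - by lra.
  - exact: (nm_ge0 scE hk).
  have [||tc tc0 htc] := small_scale del (nm 1%N k) => //.
  (* The step [t] keeps the shifted point in the contraction balls of E_m and E_(m+1) and the
     increment below the threshold of differentiability. *)
  set t := Num.min (ta / 2) (Num.min (tb / 2) (tc / 2)).
  have t0 : 0 < t by rewrite /t !lt_min !divr_gt0.
  have tta : 0 <= t < ta.
    have : t <= ta / 2 by rewrite /t ge_min lexx.
    lra.
  have ttb : 0 <= t < tb.
    have : t <= tb / 2 by rewrite /t !ge_min lexx orbT.
    lra.
  have ttc : 0 <= t < tc.
    have : t <= tc / 2 by rewrite /t !ge_min lexx !orbT.
    lra.
  have sum_lt j : lvl j u -> lvl j k ->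
      sum_nm nm j (v, u + t *: k) <= sum_nm nm j (v, u) + t * nm j k.
    move=> h1 h2; rewrite /sum_nm /= -addrA lerD2l.
    apply: le_trans (nmD scE h1 (lvlZ scE _ _ _ h2)) _.
    by rewrite (nmZ scE) // gtr0_norm.
  have hm : sum_nm nm m (v, u + t *: k) < s.
    have := sum_lt m hu' hk'; have := hta t tta; lra.
  have hm' : sum_nm nm m.+1 (v, u + t *: k) < s'.
    have := sum_lt m.+1 hu hk; have := htb t ttb; lra.
  have hq : lvl m (u + t *: k) by apply: (lvlD scE) => //; exact: (lvlZ scE).
  have hq' : lvl m.+1 (u + t *: k).
    by apply: (lvlD scE) => //; exact: (lvlZ scE).
  have hqU : U m.+1 (v, u + t *: k) by exact: sU'.
  pose q := (u + t *: k - f (v, u + t *: k)) - (u - f (v, u)).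
  have f_lvl j p : U j p -> lvl j (f p) by case: hf0 => -[_ _ h _] _; exact: h.
  have ql : lvl m.+1 q by do 2?[apply: (lvlB scE) => //]; exact: f_lvl.
  have ukd : u + t *: k - u = t *: k by rewrite addrC addKr.
  (* The difference quotient of B in the direction [k]; its E_0-distance to D_2 B applied to [k] is
     the remainder of [f] divided by [t]. *)
  exists (t^-1 *: q); split.
  - exact: (lvlZ scE).
  - rewrite (nmZ scE) // gtr0_norm ?invr_gt0 // mulrC ler_pdivrMr //.
    apply: le_trans (sB' _ _ _ hv hq' hu hm' hs') _.
    by rewrite ukd (nmZ scE) // gtr0_norm // mulrCA mulrC.
  - rewrite (nmZ scE) ?gtr0_norm ?invr_gt0 //; last first.
      exact: (lvl_anti scE (leqnSn m)) ql.
    rewrite mulrC ler_pdivrMr //.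
    apply: le_trans (sB _ _ _ hv hq hu' hm hs) _.
    by rewrite ukd (nmZ scE) // gtr0_norm // mulrCA mulrC.
  have -> : t^-1 *: q - (k - Df (v, u) (0, k)) =
      - (t^-1 *: (f ((v, u) + t *: (0, k)) - f (v, u)
                  - Df (v, u) (t *: (0, k)))).
    have -> : (v, u) + t *: (0, k) = (v, u + t *: k).
      by congr (_, _); rewrite /= scaler0 addr0.
    rewrite (DfZ _ _ _ hp1); set D := Df _ _.
    have -> : k - D = t^-1 *: (t *: (k - D)).
      by rewrite scalerA mulVf ?scale1r // gt_eqF.
    rewrite -scalerBr -[RHS]scalerN; congr (_ *: _).
    rewrite scalerBr /q -(addrA u (t *: k)) (addrC u) addrKA opprK.
    rewrite -(addrA (t *: k)) (addrC (t *: k)) addrKA opprK.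
    by rewrite opprD opprB opprK (addrC (f (v, u))).
  rewrite (nmN scE); last exact: (lvl0T scE).
  rewrite (nmZ scE); last exact: (lvl0T scE).
  rewrite gtr0_norm ?invr_gt0 // mulrC ltr_pdivrMr //.
  have hsn : sum_nm nm 1%N (t *: (0, k) : 'rV[R]_n * E) = t * nm 1%N k.
    by rewrite /sum_nm /= scaler0 rnorm0 add0r (nmZ scE) // gtr0_norm.
  apply: le_lt_trans (hdel (t *: (0, k)) _ _) _; rewrite ?hsn.
  - have -> : (v, u) + t *: (0, k) = (v, u + t *: k).
      by congr (_, _); rewrite /= scaler0 addr0.
    exact: germS1 hqU.
  - exact: htc.
  rewrite mulrCA [eps * t]mulrC ltr_pM2l // mulrAC ltr_pdivrMr; last lra.
  nra.
move=> k hk; apply/ler_addgt0Pr => eps eps0.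
have [C [del [C0 del0 hC]]] := Df_bounded m _ hp.
(* Replacing [k] by a smooth [y] costs at most 1/2 + 1 + C times the norm of [k - y]. *)
have e1 : 0 < eps / (2 + C) by rewrite divr_gt0 //; lra.
case: scE => _ _ _ _ /(_ m k hk _ e1) [y [hy hky]].
rewrite ltr_pdivlMr in hky; last lra.
have ym := hy m; have ky := lvlB scE _ _ _ hk ym.
have := smooth y (hy _).
have hpp : sum_nm nm m.+1 ((v, u) - (v, u)) < del.
  by rewrite subrr /sum_nm /= rnorm0 (nm0 scE) addr0.
have := hC _ (0, k - y) hp hpp ky; rewrite /sum_nm /= rnorm0 add0r.
have Dl z : lvl m z -> lvl m (Df (v, u) (0, z)) by move=> hz; exact: Df_lvl.
have := nmD scE (lvlB scE _ _ _ ym (Dl _ ym)) (lvlB scE _ _ _ ky (Dl _ ky)).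
have := nmB scE ky (Dl _ ky).
have -> : y - Df (v, u) (0, y) + (k - y - Df (v, u) (0, k - y)) =
    k - Df (v, u) (0, k).
  rewrite addrACA -opprD -DfD // (addrC y) subrK.
  by congr (_ - Df _ (_, _)); rewrite /= ?addr0 // (addrC y) subrK.
have := nmB scE hk ky; rewrite subKr.
have := nm_ge0 scE ky; nra.
Qed.

(** Write [k] as D_2 B applied to [k] plus [Df p (0, k)] and absorb the first term, of norm at most
    half that of [k]. Thus an inverse of D_2 f has norm at most 2. *)
Lemma D2_lower_bound m p k : U m.+1 p -> D2_contraction m p -> lvl m k ->
  nm m k <= 2 * nm m (Df p (0, k)).
Proof.
move=> hp hc hk; have Dk : lvl m (Df p (0, k)) by exact: Df_lvl.
have := nmD scE (lvlB scE _ _ _ hk Dk) Dk; rewrite subrK.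
have := hc k hk; lra.
Qed.

(** The choice mentions no level: uniqueness in E_0 identifies the solutions found on all levels.
    The default 0 is taken only if there is no solution. *)
Definition implicit_derivative p (b : 'rV[R]_n) : E :=
  xget 0 [set w | Df p (b, w) = 0].

Lemma D2_inj p b w w' : U 1%N p -> D2_contraction 0 p ->
  Df p (b, w) = 0 -> Df p (b, w') = 0 -> w = w'.
Proof.
move=> hp hc hw hw'; apply/eqP; rewrite -subr_eq0; apply/eqP.
apply: (nm_le0 scE (lvl0T scE _)).
apply: le_trans (D2_lower_bound _ _ _ hp hc (lvl0T scE _)) _.
by rewrite (Df_subr p b) // hw hw' subrr (nm0 scE) mulr0.
Qed.

(** A fixed point of [w - Df p (b, w)] in E_m solves the linearized equation, and by injectivity in
    E_0 it is the chosen solution, which therefore lies in E_m. *)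
Lemma implicit_derivativeP m p b :
  U m.+1 p -> D2_contraction 0 p -> D2_contraction m p ->
  lvl m (implicit_derivative p b) /\ Df p (b, implicit_derivative p b) = 0.
Proof.
move=> hp hc0 hc; have hp1 := germS1 hp.
have [||w hw /eqP Tw] :=
    contraction_fixpoint scE m (fun w => w - Df p (b, w)).
- by move=> x hx; apply: (lvlB scE) => //; exact: Df_lvl.
- move=> x y hx hy /=; rewrite opprD addrACA -opprD -(Df_subr p b) //.
  by apply: hc; exact: (lvlB scE).
have hw0 : Df p (b, w) = 0.
  by move: Tw; rewrite -subr_eq0 addrC addKr oppr_eq0 => /eqP.
have hid : Df p (b, implicit_derivative p b) = 0.
  exact: (xgetPex 0 (P := [set w | Df p (b, w) = 0]) (ex_intro _ w hw0)).
by rewrite (D2_inj _ _ _ _ hp1 hc0 hid hw0).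
Qed.

Lemma implicit_derivative_linear p a b b' : U 1%N p -> D2_contraction 0 p ->
  implicit_derivative p (a *: b + b') =
    a *: implicit_derivative p b + implicit_derivative p b'.
Proof.
move=> hp hc.
have H c := proj2 (implicit_derivativeP 0 p c hp hc hc).
apply: (D2_inj _ _ _ _ hp hc (H _)).
have -> : (a *: b + b', a *: implicit_derivative p b + implicit_derivative p b')
    = a *: (b, implicit_derivative p b) + (b', implicit_derivative p b') by [].
by rewrite DfD // DfZ // !H scaler0 addr0.
Qed.

Lemma implicit_derivative_bounded p : U 1%N p -> D2_contraction 0 p ->
  exists c : R, forall b, nm 0%N (implicit_derivative p b) <= c * rnorm b.
Proof.
move=> hp hc; have [C [del [C0 del0 hC]]] := Df_bounded 0 p hp.
exists (2 * C) => b; set w := implicit_derivative p b.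
have [_] := implicit_derivativeP 0 p b hp hc hc; rewrite -/w => hw.
apply: le_trans (D2_lower_bound _ _ _ hp hc (lvl0T scE _)) _.
rewrite -mulrA ler_pM2l //.
have -> : Df p (0, w) = - Df p (b, 0).
  by apply/eqP; rewrite -addr_eq0 addrC -Df_split // hw.
rewrite (nmN scE); last exact: (lvl0T scE).
have := hC p (b, 0) hp _ (lvl0T scE _); rewrite {2}/sum_nm /= (nm0 scE) addr0.
by apply; rewrite subrr /sum_nm rnorm0 (nm0 scE) addr0.
Qed.

(** * The solution germ: Lipschitz estimate, derivative and continuity of the derivative *)

Context {W : nat -> set 'rV[R]_n} {delta : 'rV[R]_n -> E}.
Hypothesis hd0 : sc0_germ (@rn_lvl R n) (@rn_nm R n) lvl nm (@quadrant R n l)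
  W delta.
Hypothesis hsol : forall v, W 0%N v -> U 0%N (v, delta v) /\ f (v, delta v) = 0.
Context {s : nat -> R}.
Hypothesis hs : forall m, contraction_radius m (s m).

(** The radii [s] are not assumed monotone, so one level does not imply the lower ones, and the
    lemmas below list each level they need. *)
Definition solution_point m v :=
  [/\ quadrant l v, W m v, lvl m (delta v) & sum_nm nm m (v, delta v) < s m].

Lemma sol_anti {m k} : (m <= k)%N -> W k `<=` W m.
Proof.
case: hd0 => -[h _ _ _] _ _ _ /subnK <-; elim: (k - m)%N => // j IH.
by rewrite addSn; exact: subset_trans (h _) IH.
Qed.

Lemma solution_radius_ex m : exists r : R, 0 < r /\
  forall v, quadrant l v -> rnorm v < r -> solution_point m v.
Proof.
case: hd0 => -[_ _ W0 hW] d0 dl /(_ m 0 (W0 m)) hc.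
have [s0 _ _] := hs m.
have [r [r0 hr]] := hW m 0 (W0 m).
have [r' [r0' hr']] := hc _ (divr_gt0 s0 (ltr0Sn R 1)).
(* Half of [s m] bounds [v], the other half bounds [delta v]. *)
exists (Num.min r (Num.min r' (s m / 2))).
split; first by rewrite !lt_min r0 r0' divr_gt0.
move=> v hv; rewrite !lt_min => /and3P[h1 h2 h3].
have Wv : W m v by apply: hr => //; rewrite /rn_nm subr0.
split=> //; first exact: dl.
have := hr' v Wv; rewrite /rn_nm subr0 d0 subr0 => /(_ h2).
rewrite /sum_nm /=; lra.
Qed.

Lemma solution_eq0 m v : solution_point m v -> f (v, delta v) = 0.
Proof. by case=> _ /(sol_anti (leq0n m)) /hsol[]. Qed.

Lemma solution_germ m v : solution_point m v -> U m (v, delta v).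
Proof. by case=> hv _ hl hlt; have [_ h _] := hs m; apply: h. Qed.

Lemma solution_D2_contraction m v :
  solution_point m v -> solution_point m.+1 v ->
  D2_contraction m (v, delta v).
Proof.
move=> [hv _ _ h] [_ _ hl h'].
exact: (D2_contractionP m _ _ _ _ (hs m) (hs m.+1)).
Qed.

(* The solution is Lipschitz into [E_1] at [v]: the mean value inequality
   along the segment from [v] to [v + b] is applied one level up, where [Df] is
   locally bounded. *)
Lemma solution_lipschitz v : solution_point 1 v -> solution_point 3 v ->
  exists C del : R, [/\ 0 < C, 0 < del & forall b, solution_point 1 (v + b) ->
    rnorm b < del -> nm 1%N (delta (v + b) - delta v) <= C * rnorm b].
Proof.
move=> h1 h3; have [hv _ dv1 dv1s] := h1; have [_ _ dv3 dv3s] := h3.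
have hp := solution_germ _ _ h3.
(* Base points in E_3 make [Df] bounded into E_2, and the mean value inequality then descends to
   E_1. *)
have [C [d [C0 d0 hC]]] := Df_bounded 2 _ hp.
have [C1 C10 hmv] := mean_value_bound scE 1.
(* The last two radii keep the segment in the ball of level 3 and its endpoint in the ball of level
   1. *)
exists (2 * (C1 * C)), (Num.min d (Num.min (s 3 - sum_nm nm 3%N (v, delta v))
  (s 1 - sum_nm nm 1%N (v, delta v)))).
split.
- by rewrite !mulr_gt0.
- by rewrite !lt_min d0 /=; lra.
move=> b h1b; have [hvb _ db1 db1s] := h1b.
rewrite !lt_min => /and3P[bd bs3 bs1].
have b0 := rnorm_ge0 b.
pose q t := (v + t *: b, delta v).
have tb t : 0 <= t <= 1 -> rnorm (t *: b) <= rnorm b.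
  by move=> ht; rewrite rnormZ ger0_norm; nra.
have qU t : 0 <= t <= 1 -> U 3 (q t).
  move=> ht; have [_ hU _] := hs 3; apply: hU => //.
    exact: quadrant_convex.
  have := rnormD v (t *: b); have := tb t ht.
  move: bs3; rewrite /sum_nm /=; lra.
have q1 t : 0 <= t <= 1 -> U 1%N (q t).
  by move=> /qU; exact: (germ_anti).
have hq01 : q 0 = (v, delta v) by rewrite /q scale0r addr0.
have hq11 : q 1 = (v + b, delta v) by rewrite /q scale1r.
have := hmv (f \o q) (fun t => Df (q t) (b, 0)) (C * rnorm b).
move=> /(_ _ _) hF.
have {}hF : nm 1%N (f (q 1) - f (q 0)) <= C1 * (C * rnorm b).
  apply: hF => [t ht|t ht eps eps0].
    split; first by apply: (Df_lvl _ _ _ (qU t ht)); exact: (lvl0 scE).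
    have := hC (q t) (b, 0) (qU t ht) _ (lvl0 scE _).
    rewrite {2}/sum_nm /= (nm0 scE) addr0; apply.
    rewrite /sum_nm /= subrr (nm0 scE) addr0 (addrC v) addrK.
    exact: le_lt_trans (tb t ht) bd.
  have e0 : 0 < eps / (rnorm b + 1) by rewrite divr_gt0 //; lra.
  have [_ [_ hdiff]] := hDf _ (q1 t ht).
  have [del [del0 hdel]] := hdiff _ e0.
  have [||t0 t00 ht0] := small_scale del (rnorm b) => //.
  exists t0 => // s' hs' hst.
  have qE : q s' = q t + (s' - t) *: (b, 0).
    congr (_, _); rewrite /= ?scaler0 ?addr0 //.
    by rewrite -addrA -scalerDl (addrC t) subrK.
  have hN : sum_nm nm 1%N ((s' - t) *: (b, 0 : E)) = `|s' - t| * rnorm b.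
    by rewrite /sum_nm /= scaler0 (nm0 scE) addr0 rnormZ.
  rewrite -(DfZ _ _ _ (q1 t ht)) /= qE.
  apply: le_trans (hdel _ _ _) _; rewrite ?hN.
  - by rewrite -qE; exact: q1.
  - by apply: ht0; rewrite normr_ge0.
  rewrite mulrCA mulrC; apply: ler_wpM2r => //.
  rewrite mulrAC ler_pdivrMr; last lra.
  nra.
rewrite hq01 hq11 (solution_eq0 _ _ h1) subr0 in hF.
have [_ hU1 hB] := hs 1.
have sb : sum_nm nm 1%N (v + b, delta v) < s 1%N.
  have := rnormD v b; move: bs1; rewrite /sum_nm /=; lra.
(* Since [f] vanishes at [(v + b, delta (v + b))], the contraction bounds [h + F] by half of [h] in
   E_1; hence [h] is at most twice [F], which the mean value inequality controls. *)
have := hB _ _ _ hvb db1 dv1 db1s sb.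
rewrite (solution_eq0 _ _ h1b) subr0 opprB.
set F := f _; set h := delta (v + b) - delta v.
have Fl : lvl 1 F.
  by case: hf0 => -[_ _ hl _] _; apply: hl; exact: hU1.
have hl : lvl 1 h by exact: (lvlB scE).
have -> : delta (v + b) + (F - delta v) = h + F.
  by rewrite /h addrAC addrA.
have := nmB scE (lvlD scE _ _ _ hl Fl) Fl; rewrite addrK.
move: hF; rewrite -/F; lra.
Qed.

(** Let h be the increment of [delta] and w the candidate. As [f] vanishes at both points,
    [Df (b, h)] is minus the remainder of [f], and it equals [Df (0, h - w)]. The lower bound
    controls h - w by this remainder, which is small relative to the E_1-size of (b, h), hence to b
    by the Lipschitz estimate. *)
Lemma solution_derivative v (eps : R) :
  solution_point 0 v -> solution_point 1 v -> solution_point 3 v -> 0 < eps ->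
  exists del : R, 0 < del /\
    forall b, solution_point 1 (v + b) -> rnorm b < del ->
      nm 0%N (delta (v + b) - delta v
              - implicit_derivative (v, delta v) b) <= eps * rnorm b.
Proof.
move=> h0 h1 h3 eps0.
have hp := solution_germ _ _ h1.
have hc := solution_D2_contraction _ _ h0 h1.
have [C [d [C0 d0 hC]]] := solution_lipschitz _ h1 h3.
have [_ [_ hdiff]] := hDf _ hp.
(* The factor 2 comes from the lower bound, 1 + C from the size of [(b, h)] relative to [b]. *)
have e0 : 0 < eps / (2 * (1 + C)) by rewrite divr_gt0 // mulr_gt0 //; lra.
have [del [del0 hdel]] := hdiff _ e0.
have dC : 0 < del / (1 + C) by rewrite divr_gt0 //; lra.
exists (Num.min d (del / (1 + C))); split; first by rewrite lt_min d0.
move=> b hb; rewrite lt_min => /andP[bd bdel].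
have h1l := hC b hb bd.
set w := implicit_derivative _ _; set h := _ - delta v in h1l *.
have [_] := implicit_derivativeP 0 _ b hp hc hc.
rewrite -/w => hw.
apply: le_trans (D2_lower_bound _ _ _ hp hc (lvl0T scE _)) _.
rewrite (Df_subr _ b) // hw subr0.
have hE : (v, delta v) + (b, h) = (v + b, delta (v + b)).
  by congr (_, _); rewrite /= addrC subrK.
have := hdel (b, h); rewrite hE (solution_eq0 _ _ hb) (solution_eq0 _ _ h1).
rewrite subr0 sub0r (nmN scE); last exact: (lvl0T scE).
move=> /(_ (solution_germ _ _ hb)).
have hN : sum_nm nm 1%N (b, h) <= (1 + C) * rnorm b by rewrite /sum_nm /=; lra.
move=> /(_ _) H.
have {}H : nm 0%N (Df (v, delta v) (b, h)) <=
    eps / (2 * (1 + C)) * sum_nm nm 1%N (b, h).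
  apply: H; apply: le_lt_trans hN _.
  by rewrite mulrC -ltr_pdivlMr //; lra.
have : eps / (2 * (1 + C)) * sum_nm nm 1%N (b, h) <= eps / 2 * rnorm b.
  apply: le_trans (ler_wpM2l (ltW e0) hN) _.
  suff -> : eps / (2 * (1 + C)) * ((1 + C) * rnorm b) = eps / 2 * rnorm b by [].
  by field; rewrite gt_eqF //; lra.
lra.
Qed.

(** The lower bound is applied at the moved point to w' - w. This leaves
    [Df (v', delta v') (b', w)], which tends to [Df (v, delta v) (b, w) = 0] with [w] held fixed, so
    no convergence of w' is presupposed. *)
Lemma implicit_derivative_continuous m v b (eps : R) :
  (forall k, (k <= m.+1)%N -> solution_point k v) -> 0 < eps ->
  exists2 del : R, 0 < del & forall v' b',
    (forall k, (k <= m.+1)%N -> solution_point k v') ->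
    rnorm (v' - v) < del -> rnorm (b' - b) < del ->
    nm m (implicit_derivative (v', delta v') b'
          - implicit_derivative (v, delta v) b) < eps.
Proof.
move=> hk eps0; have hm := hk _ (leqnn _).
have hc0 := solution_D2_contraction _ _ (hk 0%N isT) (hk 1%N isT).
have hc := solution_D2_contraction _ _ (hk m (leqnSn m)) hm.
have hp := solution_germ _ _ hm.
have [wl hw] := implicit_derivativeP m _ b hp hc0 hc.
set w := implicit_derivative _ b in wl hw *.
have e2 : 0 < eps / 2 by lra.
have [d d0 hd] := Df_continuous m _ (b, w) _ hp wl e2.
have [_ Wv _ _] := hm.
case: hd0 => _ _ _ /(_ m.+1 v Wv (d / 2) ltac:(lra)) [d' [d0' hd']].
exists (Num.min (d / 2) d'); first by rewrite lt_min d0'; lra.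
move=> v' b' hk'; rewrite !lt_min => /andP[v1 v2] /andP[b1 _].
have hm' := hk' _ (leqnn _).
have hc0' := solution_D2_contraction _ _ (hk' 0%N isT) (hk' 1%N isT).
have hc' := solution_D2_contraction _ _ (hk' m (leqnSn m)) hm'.
have hp' := solution_germ _ _ hm'.
have [wl' hw'] := implicit_derivativeP m _ b' hp' hc0' hc'.
set w' := implicit_derivative _ b' in wl' hw' *.
apply: le_lt_trans (D2_lower_bound _ _ _ hp' hc' (lvlB scE _ _ _ wl' wl)) _.
rewrite (Df_subr _ b' _ _ (germS1 hp')) hw' sub0r.
rewrite (nmN scE); last exact: Df_lvl.
have [_ Wv' _ _] := hm'.
have := hd' v' Wv' v2.
have := hd (v', delta v') (b', w) hp' wl.
rewrite hw subr0 /sum_nm /= subrr (nm0 scE) => h1 h2.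
have : nm m (Df (v', delta v') (b', w)) < eps / 2 by apply: h1; lra.
lra.
Qed.

End Linearization.

(** * Shrinking the neighborhoods and assembling the tangent germ *)

Lemma monotone_radius {R : realType} (P : nat -> R -> Prop) :
  (forall m (r r' : R), r' <= r -> P m r -> P m r') ->
  (forall m, exists r : R, 0 < r /\ P m r) ->
  exists r : nat -> R, [/\ forall m, 0 < r m, forall m, r m.+1 <= r m &
    forall k m, (k <= m)%N -> P k (r m)].
Proof.
move=> Pmono /choice[rho hrho].
(* Running minima make the balls nested, and the radius at [m] serves all levels up to [m]. *)
pose r := fix r m := if m is m'.+1 then Num.min (r m') (rho m) else rho 0%N.
have rS m : r m.+1 <= r m by rewrite /= ge_min lexx.
have r_rho m : r m <= rho m by case: m => //= m; rewrite ge_min lexx orbT.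
exists r; split=> //.
  elim=> [|m IH] /=; first by case: (hrho 0%N).
  by rewrite lt_min IH; case: (hrho m.+1).
move=> k m /subnK <-; elim: (m - k)%N => [|j IH].
  by have [_] := hrho k; apply: Pmono.
by rewrite addSn; apply: Pmono IH.
Qed.

Theorem theorem2p3 (R : realType) (E : lmodType R)
  (lvlE : nat -> set E) (nmE : nat -> E -> R) (scE : is_sc lvlE nmE)
  (n l : nat) (hln : (l <= n)%N)
  (U : nat -> set ('rV[R]_n * E)) (f : 'rV[R]_n * E -> E)
  (hf0 : @sc0_contraction_germ R n l E lvlE nmE U f)
  (hf1 : sc1_germ (@sum_lvl R n E lvlE) (@sum_nm R n E nmE) lvlE nmE (@quadE R n l E) U f)
  (W : nat -> set 'rV[R]_n) (delta : 'rV[R]_n -> E)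
  (hd0 : sc0_germ (@rn_lvl R n) (@rn_nm R n) lvlE nmE (@quadrant R n l) W delta)
  (hsol : forall v, W 0%N v -> U 0%N (v, delta v) /\ f (v, delta v) = 0) :
  exists W' : nat -> set 'rV[R]_n,
    (forall m, W' m `<=` W m) /\
    sc1_germ (@rn_lvl R n) (@rn_nm R n) lvlE nmE (@quadrant R n l) W' delta.
Proof.
have [_ [Df [hDf hT]]] := hf1.
have [s hs] := choice (contraction_radius_ex hf0).
pose SP := @solution_point R E lvlE nmE n l W delta s.
have [|r [r0 rS hr]] := @monotone_radius R
  (fun m r => forall v, quadrant l v -> rnorm v < r -> SP m v) _
  (solution_radius_ex hd0 hs).
  by move=> m r r' rr' h v hv hlt; apply: h => //; exact: lt_le_trans rr'.
have quad0 : quadrant l (0 : 'rV[R]_n) by move=> i _; rewrite mxE.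
(* Differentiability at a point of [W'_1] uses the solution in [E_3]. *)
pose W' m (v : 'rV[R]_n) := quadrant l v /\ rnorm v < r (m + 2)%N.
have W'S m : W' m.+1 `<=` W' m.
  by move=> v [hv hlt]; split=> //; apply: lt_le_trans hlt (rS _).
have W'P m k v : W' m v -> (k <= m + 2)%N -> SP k v.
  by move=> [hv hlt] km; apply: hr km _ hv hlt.
have W'W m : W' m `<=` W m.
  by move=> v /W'P /(_ (leq_addr 2 m)) [].
have W'0 m : W' m 0 by split; rewrite ?rnorm0.
have W'open m v : W' m v -> exists d : R, 0 < d /\
    forall v', quadrant l v' -> rnorm (v' - v) < d -> W' m v'.
  move=> [hv hlt]; exists (r (m + 2)%N - rnorm v); split; first lra.
  move=> v' hv' h; split=> //.
  by have := rnormD (v' - v) v; rewrite subrK; lra.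
have [_ d0 dl dc] := hd0.
have hc0 m v : W' m v ->
    @D2_contraction R E lvlE nmE n Df 0 (v, delta v).
  by move=> hv; apply: (solution_D2_contraction scE hf0 hDf hT (W := W) hs);
    apply: W'P hv _; rewrite addn2.
have sU m k v : W' m v -> (k <= m + 2)%N -> U k (v, delta v).
  by move=> hv km; apply: (solution_germ (W := W) hs); apply: W'P hv km.
pose Dd v b := @implicit_derivative R E n Df (v, delta v) b.
have Dlin m v a b b' : W' m v -> Dd v (a *: b + b') = a *: Dd v b + Dd v b'.
  move=> hv; apply: (implicit_derivative_linear scE hf0 hDf hT).
    by apply: sU hv _; rewrite addn2.
  exact: hc0 hv.
exists W'; split=> //; split.
  split=> //.
  - split=> //.
    + by move=> m v [].
    + move=> m v /W'open[d [dp hd]]; exists d; split=> // v' hv' _.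
      exact: hd.
  - by move=> m v /W'W; exact: dl.
  - move=> m v hv eps eps0; have [d [dp hd]] := dc m v (W'W _ _ hv) eps eps0.
    by exists d; split=> // v' /W'W; exact: hd.
exists Dd; split.
  move=> v hv; split; [by move=> a h k; exact: Dlin hv|split].
    apply: (implicit_derivative_bounded scE hf0 hDf hT); last exact: hc0 hv.
    exact: sU hv _.
  move=> eps eps0.
  have [|||d [dp hd]] :=
      solution_derivative scE hf0 hDf hT hd0 hsol hs v eps _ _ _ eps0.
  - exact: W'P hv _.
  - exact: W'P hv _.
  - exact: W'P hv _.
  by exists d; split=> // b hb; apply: hd; exact: W'P hb _.
(* It remains to see that the tangent map is an sc^0-germ; on its level [m] the base point lies in
   [W' m.+1], hence is a solution point up to level m + 3. *)
split.
- split.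
  + by move=> m [v b] [/= hv _]; split=> //; exact: W'S.
  + by move=> m [v b] [/= [hv _] _].
  + by move=> m; split=> //; exact: W'0.
  + move=> m [v b] [/= /W'open[d [dp hd]] _]; exists d; split=> //.
    move=> [v' b'] [/= hv' _] _; rewrite /tnm /rn_nm /= => h; split=> //.
    by apply: hd => //; have := rnorm_ge0 (b' - b); lra.
(* Linearity with scalar -1 at the zero vector gives the value 0. *)
- congr (_, _) => //=.
  have := Dlin 0%N 0 (-1) 0 0 (W'0 _).
  by rewrite scaler0 addr0 scaleN1r addNr.
- move=> m [v b] [/= hv _]; split; first by apply: dl; exact: W'W.
  apply: (proj1 (implicit_derivativeP scE hf0 hDf hT m _ b _ _ _)).
  + by apply: sU hv _; lia.
  + exact: hc0 hv.
  + by apply: (solution_D2_contraction scE hf0 hDf hT (W := W) hs);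
      apply: W'P hv _; lia.
(* Half of [eps] goes to [delta] in E_(m+1), half to its derivative in E_m. *)
move=> m [v b] [/= hv _] eps eps0.
have hv1 := W'W _ _ hv.
have e2 : 0 < eps / 2 by lra.
have [d [dp hd]] := dc m.+1 v hv1 _ e2.
have [|d' dp' hd'] := implicit_derivative_continuous scE hf0 hDf hT hd0 hs
  m v b _ _ e2.
  by move=> k km; apply: W'P hv _; lia.
exists (Num.min d d'); split; first by rewrite lt_min dp.
move=> [v' b'] [/= hv' _]; rewrite /tnm /rn_nm /= lt_min => /andP[h h'].
have := rnorm_ge0 (b' - b); have := rnorm_ge0 (v' - v) => v0 b0.
have h1 : nmE m.+1 (delta v' - delta v) < eps / 2.
  by apply: hd; [exact: W'W|rewrite /rn_nm; lra].
have h2 : nmE m (Dd v' b' - Dd v b) < eps / 2.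
  apply: hd'; [|lra|lra].
  by move=> k km; apply: W'P hv' _; lia.
lra.
Qed.
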